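(* Let $\alpha,\beta>0$ and $q>0$. Let $M$ be a random variable with values in $[0,1]$ whose distribution is equivalent at $1$ to the $\mathrm{beta}(\alpha,\beta)$ distribution, and let $R$ be the perpetuity generated by $M$ and $Q\equiv q$, i.e. the random variable satisfying $R\stackrel{d}{=}q+MR$ with $M$ independent of $R$ on the right-hand side. Then $$\lim_{x\to\infty}\frac{\ln \mathbb{P}(R\ge x)}{x\ln x}=-\frac{\beta}{q}.$$
   Context: Perpetuity: for a $[0,1]$-valued random variable $M$ and a constant $q$, the perpetuity $R$ is the solution in distribution of $R\stackrel{d}{=}q+MR$ ($M$ independent of $R$ on the right-hand side); equivalently it is the limit in distribution of $R_n=q+M_nR_{n-1}$ ($M_n$ i.i.d. copies of $M$, $M_n$ independent of $R_{n-1}$, $R_0$ arbitrary), and $R\stackrel{d}{=}\sum_{j=1}^\infty q\prod_{k=1}^{j-1}M_k$ with $M_1,M_2,\dots$ i.i.d. copies of $M$. Equivalence at 1: for probability distributions $\mu,\nu$ on $[0,1]$ and $\delta\in(0,1)$ put $\mu_\delta=\mu((1-\delta,1])$ and $\nu_\delta=\nu((1-\delta,1])$. The distributions $\mu$ and $\nu$ are equivalent at $1$ if there exist $\varepsilon>0$ and $0<d<D<\infty$ such that $d\le \mu_\delta/\nu_\delta\le D$ for all $\delta\in(0,\varepsilon]$. The $\mathrm{beta}(\alpha,\beta)$ distribution has density proportional to $t^{\alpha-1}(1-t)^{\beta-1}$ on $(0,1)$. *)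

(* Defs.v *)
From HB Require Import structures.
From mathcomp Require Import all_boot all_order all_algebra.
From mathcomp Require Import all_classical all_reals all_analysis measurable_realfun.
From mathcomp Require Import ring lra.
Set Implicit Arguments.
Unset Strict Implicit.
Unset Printing Implicit Defensive.
Import Order.TTheory GRing.Theory Num.Theory.
Import numFieldNormedType.Exports.
Local Open Scope classical_set_scope.
Local Open Scope ring_scope.

Section perpetuity.
Context d (T : measurableType d) (R : realType) (P : probability T R).

Definition independent_RV (X Y : {RV P >-> R}) : Prop :=
  forall A B : set R, measurable A -> measurable B ->
    P (X @^-1` A `&` Y @^-1` B) = (P (X @^-1` A) * P (Y @^-1` B))%E.

Definition eq_in_distribution (X Y : {RV P >-> R}) : Prop :=
  forall A : set R, measurable A -> distribution P X A = distribution P Y A.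

Definition is_perpetuity (q : R) (M X : {RV P >-> R}) : Prop :=
  independent_RV M X /\
  eq_in_distribution X (cst q \+ M \* X : {RV P >-> R}).

End perpetuity.

(* The denominator cannot vanish: x / 0 = 0 in MathComp, so [0 < d] would
   fail. *)
Definition equivalent_at_1 (R : realType) (mu nu : probability R R) : Prop :=
  exists eps d D : R, [/\ 0 < eps, 0 < d, d < D &
    forall delta : R, 0 < delta < 1 -> delta <= eps ->
      d <= fine (mu `]1 - delta, 1]%classic) /
           fine (nu `]1 - delta, 1]%classic) <= D].

Section beta_distribution.
Context (R : realType).
Local Notation leb := (@lebesgue_measure R).

Definition beta_weight (a b t : R) : R :=
  \1_(`]0, 1[) t * (t `^ (a - 1) * (1 - t) `^ (b - 1)).

Lemma beta_weight_ge0 a b t : 0 <= beta_weight a b t.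
Proof. by rewrite !mulr_ge0// powR_ge0. Qed.

Lemma measurable_beta_weight a b :
  measurable_fun [set: R] (beta_weight a b).
Proof.
have m2 : measurable_fun [set: R] (fun t : R => (1 - t) `^ (b - 1)).
  apply: (measurableT_comp (measurable_powR (b - 1))).
  exact: measurable_funB.
apply: measurable_funM; first exact: measurable_indic.
by apply: measurable_funM.
Qed.

Section measure.
Variables a b : R.

Definition beta_measure (A : set R) : \bar R :=
  (\int[leb]_(t in A) (beta_weight a b t)%:E)%E.

Let beta_measure0 : beta_measure set0 = 0%E.
Proof. by rewrite /beta_measure integral_set0. Qed.

Let beta_measure_ge0 A : (0 <= beta_measure A)%E.
Proof. by apply: integral_ge0 => t _; rewrite lee_fin beta_weight_ge0. Qed.

Let beta_measure_sigma_additive : semi_sigma_additive beta_measure.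
Proof.
move=> /= F mF tF mUF; rewrite /beta_measure; apply: cvg_toP.
  apply: ereal_nondecreasing_is_cvgn => m n mn.
  apply: lee_sum_nneg_natr => // k _ _; apply: integral_ge0 => /= x Fkx.
  by rewrite lee_fin beta_weight_ge0.
rewrite ge0_integral_bigcup//=.
- apply/measurable_funTS/measurableT_comp => //=.
  exact: measurable_beta_weight.
- by move=> x _; rewrite lee_fin beta_weight_ge0.
Qed.

HB.instance Definition _ := isMeasure.Build default_measure_display R R
  beta_measure beta_measure0 beta_measure_ge0 beta_measure_sigma_additive.

End measure.

(* [mnormalize] returns its second argument only when the first measure has
   total mass 0 or +oo; this never happens for a, b > 0, see
   [beta_distributionE]. *)
Definition beta_distribution (a b : R) : probability R R :=
  mnormalize (beta_measure a b) \d_(0 : R).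

Let g (a b t : R) : R := t `^ (a - 1) + (1 - t) `^ (b - 1).
Let G (a b t : R) : R := a^-1 * t `^ a - b^-1 * (1 - t) `^ b.

Let powR_le2 (p x : R) : 0 < p -> 2^-1 <= x <= 1 -> x `^ (p - 1) <= 2.
Proof.
move=> p0 /andP[x1 x2].
have x0 : 0 < x by apply: lt_le_trans x1; rewrite invr_gt0.
have -> : x `^ (p - 1) = x `^ p / x.
  rewrite powRB; last by rewrite (gt_eqF x0) implybT.
  by rewrite powRr1// ltW.
rewrite ler_pdivrMr//.
have h : x `^ p <= 1.
  have <- : 1 `^ p = 1 :> R by rewrite powR1.
  by apply: ge0_ler_powR => //; rewrite ?nnegrE ltW.
apply: le_trans h _; lra.
Qed.

Let weight_le (a b t : R) : 0 < a -> 0 < b -> 0 < t < 1 ->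
  beta_weight a b t <= 2 * g a b t.
Proof.
move=> a0 b0 /andP[t0 t1]; rewrite /beta_weight indicE mem_set/= ?in_itv/= ?t0// mul1r.
have pa := powR_ge0 t (a - 1); have pb := powR_ge0 (1 - t) (b - 1).
have [th|th] := leP t 2^-1.
  have := @powR_le2 b (1 - t) b0; rewrite /g; set y := _ `^ (b - 1) in pb *.
  set x := _ `^ _ in pa *.
  have h : 2^-1 <= 1 - t <= 1 by apply/andP; split; lra.
  move/(_ h) => yle; nra.
have := @powR_le2 a t a0; rewrite /g.
set x := t `^ _ in pa *; set y := _ `^ _ in pb *.
have h : 2^-1 <= t <= 1 by apply/andP; split; lra.
move/(_ h) => xle; nra.
Qed.

Let isd (a b t : R) : 0 < a -> 0 < b -> 0 < t < 1 ->
  is_derive t (1:R) (G a b) (g a b t).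
Proof.
move=> a0 b0 /andP[t0 t1].
have t1' : 0 < 1 - t by lra.
have h1 := is_derive1_powR a t0.
have h2 : is_derive t (1:R) (fun s : R => (1 - s) `^ b) (- (b * (1 - t) `^ (b - 1))).
  have h3 : is_derive t (1:R) (fun s : R => 1 - s) (-1).
    have : is_derive t (1:R) (cst (1:R) - id) (0 - 1) by apply: is_deriveB.
    by rewrite sub0r.
  have h4 := is_derive1_powR b t1'.
  have := @is_derive1_comp R _ _ t _ _ h4 h3.
  by rewrite mulrN1.
have -> : g a b t = a^-1 *: (a * t `^ (a - 1)) - b^-1 *: - (b * (1 - t) `^ (b - 1)).
  by rewrite /g !/(_ *: _)/= mulrN opprK !mulrA !mulVf ?gt_eqF// !mul1r.
exact: is_deriveB.
Qed.

Let int_g (a b e : R) : 0 < a -> 0 < b -> 0 < e -> e < 1 - e ->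
  (\int[leb]_(t in `[e, (1 - e)%R]) (g a b t)%:E = (G a b (1 - e) - G a b e)%:E)%E.
Proof.
move=> a0 b0 e0 e1.
have dG t : t \in `[e, 1 - e] -> is_derive t (1:R) (G a b) (g a b t).
  by rewrite in_itv/= => /andP[t0 t1]; apply: isd => //; apply/andP; split; lra.
have cG t : t \in `[e, 1 - e] -> {for t, continuous (G a b)}.
  move=> /dG[dGt _]; exact/differentiable_continuous/derivable1_diffP.
have cP p (t : R) : 0 < t -> {for t, continuous (fun s : R => s `^ p)}.
  move=> t0; apply/differentiable_continuous/derivable1_diffP.
  by apply: derivable_powR; rewrite in_itv/= andbT.
rewrite (@continuous_FTC2 _ _ (G a b))//.
- apply: continuous_in_subspaceT => t; rewrite inE/= in_itv/= => /andP[t0 t1].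
  have h1 := cP (a - 1) t (lt_le_trans e0 t0).
  have h2 : {for t, continuous (fun s : R => (1 - s) `^ (b - 1))}.
    apply: (@continuous_comp _ _ _ (fun s : R => 1 - s) (fun s : R => s `^ (b - 1))).
      by apply: (@cvgB _ R^o); [exact: cvg_cst|exact: cvg_id].
    by apply: cP; lra.
  exact: (@cvgD _ R^o).
- split.
  + by move=> t /subset_itv_oo_cc /dG[].
  + apply: cvg_at_right_filter; apply: cG; rewrite in_itv/= lexx/=; lra.
  + apply: cvg_at_left_filter; apply: cG; rewrite in_itv/= lexx andbT; lra.
- by move=> t /subset_itv_oo_cc /dG[_ <-]; rewrite derive1E.
Qed.

Let int_weight_le (a b e : R) : 0 < a -> 0 < b -> 0 < e -> e < 1 - e ->
  (\int[leb]_(t in `[e, (1 - e)%R]) (beta_weight a b t)%:E <=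
   (2 * (a^-1 + b^-1))%:E)%E.
Proof.
move=> a0 b0 e0 e1.
have mg : measurable_fun [set: R] (g a b).
  apply: measurable_funD; first exact: measurable_powR.
  apply: (measurableT_comp (measurable_powR (b - 1))).
  exact: measurable_funB.
have g0 t : 0 <= g a b t by rewrite addr_ge0 ?powR_ge0.
apply: (@le_trans _ _ (\int[leb]_(t in `[e, (1 - e)%R]) ((2 * g a b t)%R%:E))%E).
  apply: ge0_le_integral => //=.
  - by move=> t _; rewrite lee_fin beta_weight_ge0.
  - apply/measurable_funTS/measurableT_comp => //; exact: measurable_beta_weight.
  - apply/measurable_funTS/measurableT_comp => //.
    exact: (measurable_funM (measurable_cst (2:R)) mg).
  - move=> t; rewrite inE => /andP[]; rewrite !bnd_simp => t1 t2; rewrite lee_fin.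
    by apply: weight_le => //; apply/andP; split; lra.
under eq_integral do rewrite EFinM.
rewrite ge0_integralZl//=; last 2 first.
- exact/measurable_funTS/measurableT_comp.
- by move=> t _; rewrite lee_fin.
rewrite int_g// -EFinM lee_fin ler_pM2l// /G.
have le1 (p x : R) : 0 < p -> 0 <= x <= 1 -> 0 <= p^-1 * x `^ p <= p^-1.
  move=> p0 /andP[x0 x1]; rewrite mulr_ge0 ?powR_ge0 ?invr_ge0 ?(ltW p0)//=.
  rewrite ler_piMr ?invr_ge0 ?(ltW p0)//.
  have <- : 1 `^ p = 1 :> R by rewrite powR1.
  by apply: ge0_ler_powR => //; rewrite ?nnegrE ltW.
have h (x : R) : e <= x <= 1 - e -> 0 <= x <= 1.
  by move=> /andP[? ?]; apply/andP; split; lra.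
have /andP[u1 u2] := le1 _ e a0 (h e ltac:(apply/andP; split; lra)).
have /andP[u3 u4] := le1 _ e b0 (h e ltac:(apply/andP; split; lra)).
have /andP[u5 u6] := le1 _ (1 - e) a0 (h (1 - e) ltac:(apply/andP; split; lra)).
have /andP[u7 u8] := le1 _ (1 - e) b0 (h (1 - e) ltac:(apply/andP; split; lra)).
rewrite subKr; lra.
Qed.

Lemma beta_measure_lty (a b : R) : 0 < a -> 0 < b ->
  (beta_measure a b [set: R] < +oo)%E.
Proof.
move=> a0 b0; pose F n := `[(n.+3%:R^-1 : R), (1 - n.+3%:R^-1 : R)]%classic.
have invn n : 0 < n.+3%:R^-1 :> R by rewrite invr_gt0.
have invn3 n : n.+3%:R^-1 <= 3^-1 :> R by rewrite lef_pV2 ?posrE// ler_nat.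
have FE : \bigcup_n F n = `]0, 1[%classic.
  apply/seteqP; split => [t [n _]|t]; rewrite /F /= !in_itv/=.
    have := invn n; set u := n.+3%:R^-1 => u0 /andP[t1 t2].
    by apply/andP; split; lra.
  move=> /andP[t0 t1].
  have u0 : 0 < Num.min t (1 - t) by rewrite lt_min t0 subr_gt0.
  have [n _ /(_ n.+2)] := near_infty_natSinv_lt (PosNum u0).
  move=> /(_ (leq_trans (leqnSn n) (leqnSn _))); rewrite /= lt_min.
  set u := n.+3%:R^-1 => /andP[h1 h2].
  by exists n => //=; rewrite in_itv/= -/u; apply/andP; split; lra.
have mw : measurable_fun [set: R] (beta_weight a b) by exact: measurable_beta_weight.
have -> : beta_measure a b [set: R] =
    (\int[leb]_(t in \bigcup_n F n) (beta_weight a b t)%:E)%E.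
  rewrite FE integral_mkcond /beta_measure; apply: eq_integral => t _.
  rewrite patchE /beta_weight indicE; case: (t \in _) => //.
  by rewrite mul0r.
apply: (@le_lt_trans _ _ (2 * (a^-1 + b^-1))%:E); last exact: ltry.
have cF : (\int[leb]_(t in F n) (beta_weight a b t)%:E)%E @[n --> \oo] -->
    (\int[leb]_(t in \bigcup_n F n) (beta_weight a b t)%:E)%E.
  apply: ge0_nondecreasing_set_cvg_integral => //.
  - apply/nondecreasing_seqP => n; apply/subsetPset => t; rewrite /F /= !in_itv/=.
    have h : n.+4%:R^-1 <= n.+3%:R^-1 :> R by rewrite lef_pV2 ?posrE// ler_nat.
    move: h; set u := n.+3%:R^-1; set v := n.+4%:R^-1 => h /andP[? ?].
    by apply/andP; split; lra.
  - by move=> n; exact: measurable_itv.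
  - move=> n; apply/measurable_funTS/measurableT_comp => //.
  - by move=> n t _; rewrite lee_fin beta_weight_ge0.
apply: (cvge_le _ cF); apply: nearW => n; apply: int_weight_le => //.
have := invn3 n; set u := n.+3%:R^-1 => h; lra.
Qed.

Lemma beta_measure_gt0 (a b : R) : 0 < a -> 0 < b ->
  (0 < beta_measure a b [set: R])%E.
Proof.
move=> a0 b0; pose c : R := 4^-1 `^ a * 4^-1 `^ b.
have c0 : 0 < c by rewrite mulr_gt0 ?powR_gt0// invr_gt0.
have mw : measurable_fun [set: R] (beta_weight a b) by exact: measurable_beta_weight.
apply: (@lt_le_trans _ _ (\int[leb]_(t in `[(4^-1)%R, (1 - 4^-1)%R]) c%:E)%E).
  rewrite integral_cst//= lebesgue_measure_itv/= lte_fin ifT; last by lra.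
  by rewrite -EFinB -EFinM lte_fin mulr_gt0//; lra.
apply: (@le_trans _ _ (\int[leb]_(t in `[(4^-1)%R, (1 - 4^-1)%R]) (beta_weight a b t)%:E)%E).
  apply: ge0_le_integral => //=.
  - by move=> t _; rewrite lee_fin ltW.
  - by apply/measurable_funTS/measurableT_comp.
  - move=> t; rewrite inE => /andP[]; rewrite !bnd_simp => t1 t2; rewrite lee_fin.
    rewrite /beta_weight indicE mem_set/= ?in_itv/=; last by apply/andP; split; lra.
    have h (p x : R) : 0 < p -> 4^-1 <= x <= 1 -> 4^-1 `^ p <= x `^ (p - 1).
      move=> p0 /andP[x1 x2].
      have x0 : 0 < x by apply: lt_le_trans x1; rewrite invr_gt0.
      apply: (@le_trans _ _ (x `^ p)).
        apply: ge0_ler_powR => //; rewrite ?nnegrE ?ltW// invr_ge0//.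
      by rewrite -(mulr_powRB1 (ltW x0) p0) ler_piMl// powR_ge0.
    rewrite mul1r; apply: ler_pM; rewrite ?powR_ge0//; apply: h => //; apply/andP; split; lra.
apply: ge0_subset_integral => //=.
- exact/measurable_funTS/measurableT_comp.
- by move=> t _; rewrite lee_fin beta_weight_ge0.
Qed.

Lemma beta_distributionE (a b : R) (A : set R) : 0 < a -> 0 < b ->
  beta_distribution a b A =
  (beta_measure a b A * (fine (beta_measure a b [set: R]))^-1%:E)%E.
Proof.
move=> a0 b0; rewrite /beta_distribution/= /mnormalize ifF//.
by rewrite gt_eqF ?beta_measure_gt0//= lt_eqF// beta_measure_lty.
Qed.

End beta_distribution.

(* Main.v *)
(** Put F u := P(X >= u q) and m(delta) := P(M > 1 - delta), which is of order
    delta^beta by equivalence with the beta law.  The equation X = q + M X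
    first forces X >= q almost surely.

    Lower bound: M > 1 - delta and X >= (y-1)/(1-delta) q imply q + M X >= y q.
    With delta = theta/u, each such step lowers a level y <= u by at least
    1 - theta, so F u >= m(theta/u)^n with n <= u/(1-theta); then let theta -> 0.

    Upper bound: q + M X >= (y+1) q implies X >= y q, and also X >= (y+2) q
    unless M > y/(y+2).  Hence F(y+1) <= e F(y) + (1-e) F(y+2) with
    e = m(2/(y+2)), i.e. F is a subsolution on every unit lattice, it vanishes at
    infinity, and exp(B + c u - beta u ln u) is a supersolution for suitable
    B and c; conclude by a maximum principle. *)
Require Import Defs.
From HB Require Import structures.
From mathcomp Require Import all_boot all_order all_algebra.
From mathcomp Require Import all_classical all_reals all_analysis measurable_realfun.
From mathcomp Require Import ring lra.
Set Implicit Arguments.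
Unset Strict Implicit.
Unset Printing Implicit Defensive.
Import Order.TTheory GRing.Theory Num.Theory.
Import numFieldNormedType.Exports.
Local Open Scope classical_set_scope.
Local Open Scope ring_scope.

(** * Asymptotics of functions obeying the two tail inequalities *)

(** At the first index where [f] exceeds [h], the difference [g] rises from a nonpositive to a
    positive value. From there it can never decrease, so [f] stays above a positive constant because
    [h >= 0], which contradicts the convergence of [f] to 0. *)
Lemma maximum_principle (R : realType) (f h e : R^nat) :
  (forall n, 0 <= e n < 1) ->
  (forall n, f n.+1 <= e n * f n + (1 - e n) * f n.+2) ->
  (forall n, e n * h n + (1 - e n) * h n.+2 <= h n.+1) ->
  (forall n, 0 <= h n) -> f 0%N <= h 0%N -> f @ \oo --> 0 ->
  forall n, f n <= h n.
Proof.
move=> e01 fsub hsup h0 fh0 f0 n; elim: n => // n IHn.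
rewrite leNgt; apply/negP => hf.
pose g k := f k - h k.
(* Once [g] increases, it increases forever. *)
have incr j : g n.+1 <= g (n.+1 + j)%N /\ g (n.+1 + j)%N <= g (n.+2 + j)%N.
  elim: j => [|j [IH1 IH2]].
    rewrite !addn0; split => //; rewrite /g.
    have /andP[e0 e1] := e01 n; have := fsub n; have := hsup n => ? ?.
    (* The term [e n * g n] is nonpositive by [IHn], so [g n.+1 <= (1 - e n) * g n.+2]; the strict
       bound [e n < 1] allows the factor to be cancelled. *)
    rewrite -(ler_pM2l (_ : 0 < 1 - e n)) ?subr_gt0//.
    nra.
  rewrite !addnS !addSn; rewrite !addSn in IH1 IH2.
  split; first exact: le_trans IH2.
  rewrite /g in IH2 *.
  have /andP[e0 e1] := e01 (n + j).+1; have := fsub (n + j).+1; have := hsup (n + j).+1 => ? ?.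
  rewrite -(ler_pM2l (_ : 0 < 1 - e (n + j).+1)) ?subr_gt0//.
  nra.
have g0 : 0 < g n.+1 by rewrite subr_gt0.
have /cvgr_lt /(_ _ g0) [N _ HN] := f0.
have := HN (n.+1 + N)%N (leq_addl _ _) => /=.
rewrite ltNge => /negP; apply.
have [+ _] := incr N; rewrite {2}/g => gN.
by apply: le_trans gN _; rewrite lerBlDr lerDl.
Qed.

(** This controls the ratio of exp(c u - b u ln u) at points one unit apart. The upper bound comes
    from ln(1 + 1/y) <= 1/y, used once with weight y and once with weight 1. *)
Lemma xlnx_step (R : realType) (y : R) : 1 <= y ->
  ln (y + 1) <= (y + 1) * ln (y + 1) - y * ln y <= ln y + 2.
Proof.
move=> y1; have y0 : 0 < y by lra.
have lny : 0 <= ln y by exact: ln_ge0.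
have lnle : ln y <= ln (y + 1) by rewrite ler_ln ?posrE//; lra.
have : y * (ln (y + 1) - ln y) <= 1.
  rewrite -ln_div ?posrE//; last by lra.
  rewrite mulrDl divff ?gt_eqF// mulrC -ler_pdivlMr//.
  by apply: le_ln1Dx; rewrite (lt_le_trans (@ltrN10 R))// divr_ge0// ltW.
nra.
Qed.

Lemma xlnx_le (R : realType) (x y : R) : 1 <= x -> x <= y -> x * ln x <= y * ln y.
Proof.
move=> x1 xy; apply: ler_pM => //; [lra|exact: ln_ge0|].
by rewrite ler_ln ?posrE//; lra.
Qed.

(** Beyond [y0] the barrier [h] is a supersolution because [e y * h y] and [h (y + 2)] are each at
    most half of [h (y + 1)]. The maximum principle is then applied on the lattice of step 1 through
    [u]. *)
Lemma tail_upper_bound (R : realType) (F e : R -> R) (b k y1 : R) :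
  0 < b -> (forall u, F u <= 1) -> F u @[u --> +oo] --> 0 ->
  (forall y, 0 < y -> F (y + 1) <= e y * F y + (1 - e y) * F (y + 2)) ->
  (forall y, 0 <= e y) ->
  (forall y, y1 <= y -> e y <= expR (k - b * ln y)) ->
  exists B c y0, forall u, y0 <= u -> F u <= expR (B + c * u - b * (u * ln u)).
Proof.
move=> b0 F1 F0 FU e0 ek.
(* In [h1] the exponent must absorb [k], the [2 * b] from [xlnx_step], and 1 for the factor 2 <= exp
   1. The maximum with 0 keeps [c] positive even for negative [k]. *)
pose c := 2 * b + 1 + Num.max 0 k.
have ck : 2 * b + 1 + k <= c by rewrite lerD2l le_max lexx orbT.
have c0 : 2 * b + 1 <= c by rewrite lerDl le_max lexx.
(* The last term makes [b * ln y >= c + 1], which gives both [h2] and [e y < 1]. *)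
pose y0 := Num.max (Num.max y1 1) (expR ((c + 1) / b)).
(* This makes [h >= 1 >= F] on [y0, y0 + 1], where every lattice starts. *)
pose B := b * ((y0 + 1) * ln (y0 + 1)).
pose h u := expR (B + c * u - b * (u * ln u)).
have y01 : 1 <= y0 by rewrite !le_max lexx orbT.
have y0y1 : y1 <= y0 by rewrite !le_max lexx.
have lny y : y0 <= y -> c + 1 <= b * ln y.
  move=> yy; rewrite mulrC -ler_pdivrMr// -ler_expR lnK ?posrE//; last lra.
  by apply: le_trans yy; rewrite le_max lexx orbT.
have exp1 : 2 <= expR 1 :> R by have := expR_ge1Dx (1 : R); lra.
have h1 y : y0 <= y -> 2 * e y * h y <= h (y + 1).
  move=> yy; have /andP[_ s2] := xlnx_step (le_trans y01 yy).
  apply: (@le_trans _ _ (expR 1 * expR (k - b * ln y) * h y)).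
    rewrite ler_wpM2r ?expR_ge0//; apply: ler_pM => //.
    by apply: ek; lra.
  rewrite -!expRD ler_expR; nra.
have h2 y : y0 <= y -> 2 * h (y + 2) <= h (y + 1).
  move=> yy; have : 1 <= y + 1 by lra.
  move=> /xlnx_step /andP[+ _]; rewrite -addrA -[1 + 1]/(2 : R) => s1.
  apply: (@le_trans _ _ (expR 1 * h (y + 2))); first by rewrite ler_wpM2r ?expR_ge0.
  have := lny (y + 2); rewrite -expRD ler_expR => /(_ ltac:(lra)) ?; nra.
have e1 y : y0 <= y -> e y < 1.
  move=> yy; apply: le_lt_trans (ek _ _) _; first by lra.
  rewrite expR_lt1; have := lny _ yy; lra.
exists B, c, y0 => u yu.
(* [s] is the point of [y0, y0 + 1) congruent to [u] modulo 1. *)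
pose n := Num.truncn (u - y0); pose s := u - n%:R.
have un : n%:R <= u - y0 < n.+1%:R by apply: truncn_itv; rewrite subr_ge0.
have us : u = s + n%:R by rewrite subrK.
have [s0 s1] : y0 <= s /\ s <= y0 + 1.
  move: un => /andP[]; rewrite -natr1 /s => ? ?; split; lra.
rewrite [in leLHS]us us -/(h _).
have sm m : y0 <= s + m%:R by rewrite ler_wpDr.
have S1 m : s + m.+1%:R = s + m%:R + 1 by rewrite -natr1 addrA.
have S2 m : s + m.+2%:R = s + m%:R + 2 by rewrite -[m.+2]addn2 natrD addrA.
apply: (@maximum_principle _ (fun m => F (s + m%:R)) (fun m => h (s + m%:R))
  (fun m => e (s + m%:R))) => [m|m|m|m||].
- by rewrite e0 e1.
- by rewrite S2 S1; apply: FU; have := sm m; lra.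
- rewrite S2 S1; have := h1 _ (sm m); have := h2 _ (sm m).
  have := expR_ge0 (B + c * (s + m%:R + 2) - b * ((s + m%:R + 2) * ln (s + m%:R + 2))).
  rewrite -/(h (s + m%:R + 2)); have := e0 (s + m%:R); nra.
- exact: expR_ge0.
- rewrite addr0; apply: le_trans (F1 _) _; rewrite -[leLHS]expR0 ler_expR.
  have : 1 <= s by lra.
  move=> /xlnx_le /(_ s1) ?; rewrite /B; nra.
- apply: (cvg_comp _ _ _ F0).
  apply/cvgryPge => A; near=> m.
  have : A - s <= m%:R by near: m; apply: nbhs_infty_ger.
  lra.
Unshelve. all: by end_near. Qed.

Lemma tail_lower_bound (R : realType) (F m : R -> R) :
  (forall u, u <= 1 -> F u = 1) -> {homo F : x y /~ x <= y} ->
  (forall y delta, 1 <= y -> 0 < delta < 1 ->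
    m delta * F ((y - 1) / (1 - delta)) <= F y) ->
  forall theta u, 0 < theta < 1 -> 1 <= u -> 0 < m (theta / u) <= 1 ->
  0 < F u /\ u / (1 - theta) * ln (m (theta / u)) <= ln (F u).
Proof.
move=> F1 Fmono Fstep theta u /andP[th0 th1] u1 /andP[m0 m1].
have u0 : 0 < u by lra.
have t0 : 0 < 1 - theta by lra.
set p := m (theta / u) in m0 m1 *.
have thu : 0 < theta / u < 1 by rewrite divr_gt0//= ltr_pdivrMr//; lra.
(* The value [theta / u] is fixed by the top level [u] and kept on all lower levels, so every step
   costs the same factor [p]. *)
have pow_le n : forall y, y <= u -> y <= 1 + n%:R * (1 - theta) -> p ^+ n <= F y.
  elim: n => [|n IHn] y yu yn.
    by rewrite mul0r addr0 in yn; rewrite expr0 F1.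
  have [y1|y1] := leP y 1; first by rewrite F1// exprn_ile1// ltW.
  apply: le_trans (Fstep y (theta / u) (ltW y1) thu).
  rewrite exprS ler_wpM2l// ?(ltW m0)//.
  apply: le_trans (IHn (y - (1 - theta)) _ _) _; first lra.
    by move: yn; rewrite -natr1; lra.
  apply: Fmono.
  have /andP[d0 d1] := thu; set dl := theta / u in d0 d1 *.
  (* The comparison (y - 1)/(1 - dl) <= y - (1 - theta) amounts to dl (y - (1 - theta)) <= theta,
     which follows from this bound. *)
  have dly : dl * y <= theta.
    have <- : dl * u = theta by rewrite /dl divfK ?gt_eqF.
    by rewrite ler_wpM2l// ltW.
  rewrite ler_pdivrMr; last lra.
  nra.
have [z0 zu] : 0 <= (u - 1) / (1 - theta) /\ (u - 1) / (1 - theta) * (1 - theta) = u - 1.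
  by split; [rewrite divr_ge0; lra|rewrite divfK ?gt_eqF].
(* Enough steps to descend from [u] to level 1. Rounding up is harmless: n (1 - theta) <= (u - 1) +
   (1 - theta) <= u. *)
pose n := (Num.truncn ((u - 1) / (1 - theta))).+1.
have /andP[n1 n2] := truncn_itv z0; rewrite -/n in n2.
have pF : p ^+ n <= F u.
  apply: pow_le => //.
  have : (u - 1) / (1 - theta) * (1 - theta) <= n%:R * (1 - theta).
    by rewrite ler_wpM2r// ltW.
  by rewrite zu; lra.
have F0 : 0 < F u by apply: lt_le_trans pF; rewrite exprn_gt0.
split=> //.
have : ln (p ^+ n) <= ln (F u) by rewrite ler_ln ?posrE// exprn_gt0.
apply: le_trans; rewrite lnXn// -[leRHS]mulr_natl.
apply: ler_wnM2r; first exact: ln_le0.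
rewrite /n -natr1 ler_pdivlMr// mulrDl mul1r.
have : (Num.truncn ((u - 1) / (1 - theta)))%:R * (1 - theta) <= u - 1.
  by rewrite -[leRHS]zu ler_wpM2r// ltW.
lra.
Qed.

Lemma log_tail_limit (R : realType) (F : R -> R) (b q : R) : 0 < b -> 0 < q ->
  (exists B c y0, forall u, y0 <= u -> F u <= expR (B + c * u - b * (u * ln u))) ->
  (forall theta, 0 < theta < 1 -> exists k u0, forall u, u0 <= u ->
    0 < F u /\ u / (1 - theta) * (k - b * ln u) <= ln (F u)) ->
  ln (F (x / q)) / (x * ln x) @[x --> +oo] --> - (b / q).
Proof.
move=> b0 q0 [B [c [y0 up]]] lo.
apply/cvgrPdist_le => e e0.
have eq0 : 0 < e * q by rewrite mulr_gt0.
(* Chosen so that e q - theta (b + e q) = e q / 2 > 0. This is the coefficient of ln x left over in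
   the lower estimate, and it must beat a constant. *)
pose theta := (e * q / 2) / (b + e * q).
have bE : theta * (b + e * q) = e * q / 2 by rewrite /theta divfK// gt_eqF// addr_gt0.
have th01 : 0 < theta < 1.
  apply/andP; split; first by rewrite !divr_gt0// addr_gt0.
  by rewrite ltr_pdivrMr ?addr_gt0//; lra.
have [k [u0 {}lo]] := lo _ th01.
near=> x.
have x1 : 1 < x by near: x; apply: nbhs_pinfty_gt; rewrite num_real.
have lnx K : (expR K <= x) -> K <= ln x.
  by move=> Kx; rewrite -ler_expR lnK// posrE; lra.
set u := x / q; set l := ln x.
have xu : x = q * u by rewrite /u mulrC divfK// gt_eqF.
have qx A : q * A <= x -> A <= u by rewrite xu ler_pM2l.
have u1 : 1 <= u.
  by apply: qx; near: x; apply: nbhs_pinfty_ge; rewrite num_real.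
have up0 : 0 < u by exact: lt_le_trans ltr01 u1.
have uu0 : u0 <= u.
  by apply: qx; near: x; apply: nbhs_pinfty_ge; rewrite num_real.
have uy0 : y0 <= u.
  by apply: qx; near: x; apply: nbhs_pinfty_ge; rewrite num_real.
(* [l1] absorbs the linear terms of the upper estimate, where [B <= Num.max B 0 * u] since [u >= 1];
   [l2] absorbs the constants of the lower one. *)
have l1 : (Num.max B 0 + c + b * ln q) / (e * q) <= l.
  by apply: lnx; near: x; apply: nbhs_pinfty_ge; rewrite num_real.
have l2 : - (k + b * ln q) / (e * q / 2) <= l.
  by apply: lnx; near: x; apply: nbhs_pinfty_ge; rewrite num_real.
have l0 : 0 < l by rewrite /l ln_gt0.
have lnu : ln u = l - ln q by rewrite /u ln_div ?posrE//; lra.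
rewrite ler_pdivrMr// in l1; rewrite ler_pdivrMr ?divr_gt0// in l2.
have [F0 Flo] := lo _ uu0.
have Fup : ln (F u) <= B + c * u - b * (u * ln u).
  by rewrite -ler_expR lnK ?posrE// up.
have xl0 : 0 < x * l by rewrite mulr_gt0//; lra.
have /andP[th0 th1] := th01.
rewrite distrC.
have -> : ln (F u) / (x * l) - - (b / q) = (ln (F u) + b * (u * l)) / (x * l).
  by rewrite xu; field; rewrite !gt_eqF.
have xlE : x * l = q * (u * l) by rewrite mulrA -xu.
have ul0 : 0 < u * l by rewrite mulr_gt0.
rewrite ler_norml; apply/andP; split.
- rewrite ler_pdivlMr// xlE.
  apply: (@le_trans _ _ (u / (1 - theta) * (k - b * ln u) + b * (u * l))); last by rewrite lerD2r.
  rewrite -lerBlDr [leRHS]mulrAC ler_pdivlMr; last lra.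
  rewrite lnu -subr_ge0.
  have : 0 <= u * (k + b * ln q + (e * q - theta * (b + e * q)) * l).
    by rewrite bE mulr_ge0 ?(ltW up0)//; lra.
  congr (0 <= _); ring.
- rewrite ler_pdivrMr// xlE -lerBrDr; apply: le_trans Fup _.
  have : Num.max B 0 * 1 <= Num.max B 0 * u by rewrite ler_wpM2l// le_max lexx orbT.
  have : B <= Num.max B 0 by rewrite le_max lexx.
  have : (Num.max B 0 + c + b * ln q) * u <= l * (e * q) * u by rewrite ler_wpM2r//; lra.
  rewrite lnu; lra.
Unshelve. all: by end_near. Qed.

(** * Mass of the beta law near 1 *)

(** The interval stops short of 1 because the integrand is unbounded there when [b < 1]; the
    fundamental theorem of calculus then applies to a continuous function. *)
Lemma integral_pow_at_1 (R : realType) (b e delta : R) :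
  0 < b -> 0 < e -> e < delta ->
  (\int[@lebesgue_measure R]_(t in `[(1 - delta)%R, (1 - e)%R]) ((1 - t) `^ (b - 1))%:E
   = ((delta `^ b - e `^ b) / b)%:E)%E.
Proof.
move=> b0 e0 ed; pose G (t : R) := - (b^-1 * (1 - t) `^ b).
have dG (t : R) : t < 1 -> is_derive t (1:R) G ((1 - t) `^ (b - 1)).
  move=> t1; have t1' : 0 < 1 - t by lra.
  have h3 : is_derive t (1:R) (fun s : R => 1 - s) (-1).
    have : is_derive t (1:R) (cst (1:R) - id) (0 - 1) by apply: is_deriveB.
    by rewrite sub0r.
  have := @is_derive1_comp R _ _ t _ _ (is_derive1_powR b t1') h3.
  rewrite mulrN1 => h.
  have -> : (1 - t) `^ (b - 1) = - (b^-1 *: - (b * (1 - t) `^ (b - 1))).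
    by rewrite /(_ *: _)/= mulrN opprK mulrA mulVf ?gt_eqF// mul1r.
  exact: is_deriveN.
have cG (t : R) : t < 1 -> {for t, continuous G}.
  by move=> /dG[dGt _]; exact/differentiable_continuous/derivable1_diffP.
rewrite (@continuous_FTC2 _ _ G)//.
- by rewrite -EFinB /G !subKr; congr EFin; field; rewrite gt_eqF.
- by lra.
- apply: continuous_in_subspaceT => t; rewrite inE/= in_itv/= => /andP[t0 t1].
  apply: (@continuous_comp _ _ _ (fun s : R => 1 - s) (fun s : R => s `^ (b - 1))).
    by apply: (@cvgB _ R^o); [exact: cvg_cst|exact: cvg_id].
  apply/differentiable_continuous/derivable1_diffP.
  by apply: derivable_powR; rewrite in_itv/= andbT; lra.
- split.
  + by move=> t; rewrite in_itv/= => /andP[_ t1]; have [] := dG t ltac:(lra).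
  + by apply: cvg_at_right_filter; apply: cG; lra.
  + by apply: cvg_at_left_filter; apply: cG; lra.
- by move=> t; rewrite in_itv/= => /andP[_ t1]; rewrite derive1E; have [_ ->] := dG t ltac:(lra).
Qed.

(** Writing t^(a-1) = t^a / t treats a < 1 and a >= 1 alike: on [1/2, 1) the numerator lies in
    [2^-a, 1] and 1/t in (1, 2]. *)
Lemma beta_weight_near_1 (R : realType) (a b t : R) : 0 < a -> 2^-1 <= t < 1 ->
  2^-1 `^ a * (1 - t) `^ (b - 1) <= beta_weight a b t <= 2 * (1 - t) `^ (b - 1).
Proof.
move=> a0 /andP[t2 t1]; have t0 : 0 < t by lra.
rewrite /beta_weight indicE mem_set/= ?in_itv/= ?t0// mul1r.
have tE : t * t `^ (a - 1) = t `^ a by rewrite mulr_powRB1// ltW.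
have ta1 : t `^ a <= 1.
  rewrite (_ : 1 = 1 `^ a); last by rewrite powR1.
  apply: ge0_ler_powR; rewrite ?nnegrE//; lra.
have ta2 : 2^-1 `^ a <= t `^ a by apply: ge0_ler_powR; rewrite ?nnegrE//; lra.
have := powR_ge0 t (a - 1); set v := t `^ (a - 1) in tE *; move=> v0.
by apply/andP; split; rewrite ler_wpM2r ?powR_ge0//; nra.
Qed.

Lemma beta_measure_near_1 (R : realType) (a b e delta : R) :
  0 < a -> 0 < b -> 0 < e -> e < delta -> delta <= 2^-1 ->
  ((2^-1 `^ a * ((delta `^ b - e `^ b) / b))%:E <=
   beta_measure a b `[(1 - delta)%R, (1 - e)%R]%classic <=
   (2 * ((delta `^ b - e `^ b) / b))%:E)%E.
Proof.
move=> a0 b0 e0 ed d2.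
have mp : measurable_fun [set: R] (fun t : R => (1 - t) `^ (b - 1)).
  apply: (measurableT_comp (measurable_powR (b - 1))).
  exact: measurable_funB.
have mpc (c : R) : measurable_fun `[1 - delta, 1 - e]%classic
    (fun t : R => (c * (1 - t) `^ (b - 1))%:E).
  apply/measurable_funTS/measurableT_comp => //.
  exact: (measurable_funM (measurable_cst c) mp).
have mw : measurable_fun `[1 - delta, 1 - e]%classic
    (fun t : R => (beta_weight a b t)%:E).
  apply/measurable_funTS/measurableT_comp => //; exact: measurable_beta_weight.
have intZ (c : R) : 0 <= c -> (\int[@lebesgue_measure R]_(t in `[(1 - delta)%R, (1 - e)%R])
    (c * (1 - t) `^ (b - 1))%:E = (c * ((delta `^ b - e `^ b) / b))%:E)%E.
  move=> c0; rewrite [RHS]EFinM -integral_pow_at_1// -ge0_integralZl//=.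
  - exact/measurable_funTS/measurableT_comp.
  - by move=> t _; rewrite lee_fin powR_ge0.
rewrite -!intZ ?powR_ge0// /beta_measure; apply/andP; split.
- apply: ge0_le_integral => //=.
  + by move=> t _; rewrite lee_fin mulr_ge0 ?powR_ge0.
  + exact: mpc.
  + move=> t; rewrite inE => /andP[]; rewrite !bnd_simp => t1 t2; rewrite lee_fin.
    by have /andP[] := @beta_weight_near_1 R a b t a0 ltac:(apply/andP; split; lra).
- apply: ge0_le_integral => //=.
  + by move=> t _; rewrite lee_fin beta_weight_ge0.
  + exact: mpc.
  + move=> t; rewrite inE => /andP[]; rewrite !bnd_simp => t1 t2; rewrite lee_fin.
    by have /andP[] := @beta_weight_near_1 R a b t a0 ltac:(apply/andP; split; lra).
Qed.

(** The interval is exhausted by [E n], which stays at distance delta/2^(n+1) from 1. The set [E 0]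
    alone gives the lower bound, with the factor 1 - 2^-b; continuity from below gives the upper
    one. *)
Lemma beta_measure_tail (R : realType) (a b delta : R) :
  0 < a -> 0 < b -> 0 < delta <= 2^-1 ->
  ((2^-1 `^ a * (1 - 2^-1 `^ b) / b * delta `^ b)%:E <=
   beta_measure a b `](1 - delta)%R, 1%R]%classic <= (2 / b * delta `^ b)%:E)%E.
Proof.
move=> a0 b0 /andP[d0 d2].
have mw (D : set R) : measurable_fun D (fun t : R => (beta_weight a b t)%:E).
  apply/measurable_funTS/measurableT_comp => //; exact: measurable_beta_weight.
(* Single points are Lebesgue null, so the endpoints can be exchanged; the union of the [E n] is
   exactly the new interval. *)
have -> : beta_measure a b `]1 - delta, 1]%classic = beta_measure a b `[1 - delta, 1[%classic.
  rewrite /beta_measure (integral_itv_obnd_cbnd (mw _)).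
  by rewrite -(integral_itv_bndo_bndc (mw _)).
have h0 n : 0 < delta / 2 ^+ n.+1 < delta.
  rewrite divr_gt0// ?exprn_gt0//= ltr_pdivrMr ?exprn_gt0//.
  by rewrite ltr_pMr// exprn_egt1// ltr1n.
have mono n : delta / 2 ^+ n.+2 <= delta / 2 ^+ n.+1.
  by rewrite ler_pM2l// lef_pV2 ?posrE ?exprn_gt0// ler_eXn2l ?ltr1n.
pose E n := `[1 - delta, 1 - delta / 2 ^+ n.+1]%classic : set R.
apply/andP; split.
  apply: (@le_trans _ _ (beta_measure a b (E 0%N))); last first.
    apply: le_measure; rewrite ?inE; [exact: measurable_itv..|].
    have := h0 0%N => /andP[? ?].
    by move=> t; rewrite /E /= !in_itv/= => /andP[-> ?]; lra.
  have /andP[h1 h2] := h0 0%N.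
  have /andP[+ _] := beta_measure_near_1 a0 b0 h1 h2 d2.
  apply: le_trans; rewrite lee_fin expr1 powRM//; last by rewrite ltW.
  by rewrite le_eqVlt; apply/orP; left; apply/eqP; field; rewrite gt_eqF.
have cE : \bigcup_n E n = `[1 - delta, 1[%classic.
  apply/seteqP; split => [t [n _]|t]; rewrite /E /= !in_itv/=.
    by have /andP[? ?] := h0 n => /andP[-> ?]; lra.
  move=> /andP[t0 t1].
  have : delta / 2 ^+ n @[n --> \oo] --> (0 : R).
    rewrite -[X in _ --> X](mulr0 delta); apply: cvgM; first exact: cvg_cst.
    rewrite (_ : (fun n => (2 ^+ n)^-1) = (fun n => (2^-1 : R) ^+ n)).
      by apply: cvg_expr; rewrite ger0_norm ?invf_lt1 ?ltr1n.
    by apply/funext => n; rewrite exprVn.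
  move=> /cvgr_lt /(_ (1 - t)); rewrite subr_gt0 => /(_ t1)[N _ HN].
  by exists N => //=; rewrite in_itv/= t0/=; have := HN N.+1 (leqnSn _) => /=; lra.
rewrite -cE.
have cvgE : beta_measure a b (E n) @[n --> \oo] --> beta_measure a b (\bigcup_n E n).
  apply: nondecreasing_cvg_mu.
  - by move=> n; exact: measurable_itv.
  - by rewrite cE; exact: measurable_itv.
  - apply/nondecreasing_seqP => n; apply/subsetPset => t; rewrite /E /= !in_itv/=.
    by have := mono n => ? /andP[-> ?]; lra.
apply: (cvge_le _ cvgE); apply: nearW => n.
have /andP[h1 h2] := h0 n.
have /andP[_ h] := beta_measure_near_1 a0 b0 h1 h2 d2.
apply: le_trans h _; rewrite lee_fin -mulrA ler_pM2l// [leRHS]mulrC.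
by rewrite ler_pM2r ?invr_gt0// gerBl powR_ge0.
Qed.

(** The total mass [Z] is positive and finite, so normalisation only changes the constants. *)
Lemma beta_distribution_tail (R : realType) (a b : R) : 0 < a -> 0 < b ->
  exists C1 C2, [/\ 0 < C1, 0 < C2 & forall delta, 0 < delta <= 2^-1 ->
    C1 * delta `^ b <= fine (beta_distribution a b `]1 - delta, 1]%classic)
      <= C2 * delta `^ b].
Proof.
move=> a0 b0; pose Z := fine (beta_measure a b [set: R]).
have Z0 : 0 < Z by apply: fine_gt0; rewrite beta_measure_gt0// beta_measure_lty.
exists (2^-1 `^ a * (1 - 2^-1 `^ b) / b / Z), (2 / b / Z); split.
- rewrite !divr_gt0// mulr_gt0 ?powR_gt0 ?invr_gt0// subr_gt0.
  rewrite [ltRHS](_ : 1 = 1 `^ b); last by rewrite powR1.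
  apply: gt0_ltr_powR => //; rewrite ?nnegrE//; lra.
- by rewrite !divr_gt0.
move=> delta dd; have := beta_measure_tail a0 b0 dd.
rewrite beta_distributionE// -/Z.
set v := beta_measure a b _; move=> /andP[v1 v2].
have vfin : v \is a fin_num.
  by rewrite ge0_fin_numE ?measure_ge0// (le_lt_trans v2)// ltry.
rewrite -(fineK vfin) in v1 v2 *; rewrite !lee_fin in v1 v2.
rewrite -EFinM/= 2!(mulrAC _ Z^-1).
by rewrite !ler_pM2r ?invr_gt0// v1 v2.
Qed.

(** * Tail functions of real random variables *)

Definition tail d (T : measurableType d) (R : realType) (P : probability T R)
  (X : {RV P >-> R}) (x : R) : R := fine (P [set w | x <= X w]).

Lemma measurable_tail d (T : measurableType d) (R : realType)
  (P : probability T R) (X : {RV P >-> R}) (x : R) :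
  measurable [set w | x <= X w].
Proof.
have -> : [set w | x <= X w] = X @^-1` `[x, +oo[%classic.
  by apply/seteqP; split => w; rewrite /= in_itv/= andbT.
exact: measurable_funPTI.
Qed.

Lemma EFin_tail d (T : measurableType d) (R : realType)
  (P : probability T R) (X : {RV P >-> R}) (x : R) :
  (tail X x)%:E = P [set w | x <= X w].
Proof. by rewrite fineK// fin_num_measure//; exact: measurable_tail. Qed.

Lemma tail_nonincreasing d (T : measurableType d) (R : realType)
  (P : probability T R) (X : {RV P >-> R}) :
  {homo tail X : x y /~ x <= y}.
Proof.
move=> x y xy; rewrite fine_le ?fin_num_measure//; try exact: measurable_tail.
by apply: le_measure; rewrite ?inE; [exact: measurable_tail..|move=> w /=; exact: le_trans].
Qed.

Lemma tail_cvg0 d (T : measurableType d) (R : realType)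
  (P : probability T R) (X : {RV P >-> R}) : tail X x @[x --> +oo] --> 0.
Proof.
(* [ccdf] uses a strict inequality and [tail] a weak one; the shift by 1 bridges the two. *)
have ccdf0 : fine (ccdf X (x - 1)) @[x --> +oo] --> 0.
  have /fine_cvg h := cvg_ccdfy0 X.
  apply: (cvg_comp (fun x : R => x - 1) (fun x => fine (ccdf X x)) _ h).
  apply/cvgryPge => A; near=> x; rewrite lerBrDr.
  by near: x; apply: nbhs_pinfty_ge; rewrite num_real.
apply: (squeeze_cvgr _ (cvg_cst 0) ccdf0); near=> x.
rewrite fine_ge0//= fine_le ?fin_num_measure//; try exact: measurable_tail.
apply: le_measure; rewrite ?inE; [exact: measurable_tail|exact: measurable_funPTI|].
by move=> w /= xw; rewrite in_itv/= andbT; lra.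
Unshelve. all: by end_near. Qed.

(** * Tail inequalities for the perpetuity *)

Section perpetuity_tail.
Context d (T : measurableType d) (R : realType) (P : probability T R).
Context (q : R) (M X : {RV P >-> R}).
Hypotheses (q_gt0 : 0 < q) (M01 : forall w : T, 0 <= M w <= 1)
  (X_perp : is_perpetuity q M X).

Let m delta := fine (distribution P M `]1 - delta, 1]%classic).

Let affine_tail x : tail X x = fine (P [set w | x <= q + M w * X w]).
Proof.
have /(_ _ (measurable_itv `[x, +oo[)) := X_perp.2.
rewrite /tail /distribution/= /pushforward.
have preE (Y : T -> R) : Y @^-1` `[x, +oo[%classic = [set w | x <= Y w].
  by apply/seteqP; split => w; rewrite /= in_itv/= andbT.
by rewrite !preE => ->.
Qed.

Let measurable_affine x : measurable [set w | x <= q + M w * X w].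
Proof. exact: (@measurable_tail _ _ _ P (cst q \+ M \* X : {RV P >-> R})). Qed.

Let indep (A : set R) x : measurable A ->
  fine (P (M @^-1` A `&` [set w | x <= X w])) = fine (distribution P M A) * tail X x.
Proof.
move=> mA; rewrite -fineM ?fin_num_measure//; last exact: measurable_tail.
congr fine; have := X_perp.1 _ `[x, +oo[%classic mA (measurable_itv _).
have -> // : X @^-1` `[x, +oo[%classic = [set w | x <= X w].
by apply/seteqP; split => w; rewrite /= in_itv/= andbT.
Qed.

(** For t <= q the number t - q is nonpositive, so X >= t - q survives multiplication by M in [0,1]
    and gives q + M X >= t. Iterating compares the tail at x with the tail at x - n q, which tends
    to 1. *)
Lemma tail_perpetuity1 x : x <= q -> tail X x = 1.
Proof.
move=> xq.
have step t : t <= q -> tail X (t - q) <= tail X t.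
  move=> tq; rewrite [leRHS]affine_tail fine_le ?fin_num_measure//; try exact: measurable_tail.
  apply: le_measure; rewrite ?inE; [exact: measurable_tail|exact: measurable_affine|].
  by move=> w /=; have /andP[M0 M1] := M01 w; nra.
have steps n : tail X (x - n%:R * q) <= tail X x.
  elim: n => [|n IHn]; first by rewrite mul0r subr0.
  apply: le_trans IHn; rewrite -natr1 mulrDl mul1r opprD addrA; apply: step.
  by rewrite lerBlDr ler_wpDr// mulr_ge0// ltW.
apply/eqP; rewrite eq_le; apply/andP; split.
  rewrite -[leRHS]/(fine 1%E) fine_le ?fin_num_measure//; try exact: measurable_tail.
  by apply: probability_le1; exact: measurable_tail.
rewrite -lee_fin.
apply: (cvge_le _ (cvg_ccdfNy1 X)).
near=> r.
(* With this [n], x - n q < r, so the event X > r already lies in X >= x - n q. *)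
pose n := (Num.truncn ((x - r) / q)).+1.
have xr : 0 <= (x - r) / q.
  rewrite divr_ge0 ?(ltW q_gt0)// subr_ge0.
  by near: r; apply: nbhs_ninfty_le; rewrite num_real.
have /andP[_ n1] := truncn_itv xr; rewrite -/n ltr_pdivrMr// in n1.
have := steps n; rewrite -lee_fin; apply: le_trans.
rewrite EFin_tail; apply: (@le_measure _ _ _ P (X @^-1` _)); rewrite ?inE.
- exact: measurable_funPTI.
- exact: measurable_tail.
by move=> w /=; rewrite in_itv/= andbT; lra.
Unshelve. all: by end_near. Qed.

Lemma tail_perpetuity_ge y delta : 1 <= y -> 0 < delta < 1 ->
  m delta * tail X ((y - 1) / (1 - delta) * q) <= tail X (y * q).
Proof.
move=> y1 /andP[d0 d1]; rewrite /m -indep; last exact: measurable_itv.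
rewrite [leRHS]affine_tail fine_le ?fin_num_measure//.
- by apply: measurableI; [exact: measurable_funPTI|exact: measurable_tail].
apply: le_measure; rewrite ?inE//.
  by apply: measurableI; [exact: measurable_funPTI|exact: measurable_tail].
move=> w /= [+ Xw]; rewrite in_itv/= => /andP[M1 M2].
(* The two lower bounds may be multiplied because both are nonnegative, the second one thanks to
   [1 <= y]. *)
have : (1 - delta) * ((y - 1) / (1 - delta) * q) <= M w * X w.
  apply: ler_pM => //; [lra| |exact: ltW].
  by rewrite mulr_ge0 ?(ltW q_gt0)// divr_ge0; lra.
by rewrite mulrA (mulrC (1 - delta)) divfK ?gt_eqF ?subr_gt0//; lra.
Qed.

Lemma tail_perpetuity_le y : 0 < y ->
  let p := m (2 / (y + 2)) in
  tail X ((y + 1) * q) <= p * tail X (y * q) + (1 - p) * tail X ((y + 2) * q).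
Proof.
(* Here 1 - delta = y/(y + 2), so off [A] the bound M X >= y q forces X >= (y + 2) q. On [A] only X
   >= M X >= y q is kept. Independence splits both probabilities. *)
move=> y0 /=; set delta := 2 / (y + 2); set A := `]1 - delta, 1]%classic : set R.
have mA : measurable A by exact: measurable_itv.
have -> : 1 - m delta = fine (distribution P M (~` A)).
  by rewrite probability_setC// fineB ?fin_num_measure.
rewrite affine_tail /m -!indep//; last exact: measurableC.
have mI B x : measurable B -> measurable (M @^-1` B `&` [set w | x <= X w]).
  by move=> mB; apply: measurableI; [exact: measurable_funPTI|exact: measurable_tail].
have mI1 := mI _ (y * q) mA; have mI2 := mI _ ((y + 2) * q) (measurableC mA).
rewrite -fineD ?fin_num_measure// fine_le ?fin_numD ?fin_num_measure//.
apply: le_trans (measureU2 _ mI1 mI2).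
apply: le_measure; rewrite ?inE//; first exact: measurableU.
move=> w /= MX; have /andP[M0 M1] := M01 w.
have Xy : y * q <= M w * X w by lra.
have yq : 0 < y * q by rewrite mulr_gt0.
have X0 : 0 < X w.
  rewrite ltNge; apply/negP => X0.
  by have := mulr_ge0_le0 M0 X0; lra.
have XM : M w * X w <= X w by rewrite ler_piMl// ltW.
have [wA|wA] := boolP (1 - delta < M w).
  by left; split; [rewrite /A/= in_itv/= wA M1|lra].
right; split; first by rewrite /A/= in_itv/= (negbTE wA).
rewrite -leNgt in wA.
have dE : 1 - delta = y / (y + 2) by rewrite /delta; field; rewrite gt_eqF//; lra.
rewrite dE ler_pdivlMr in wA; last lra.
have : y * q * (y + 2) <= y * X w.
  by have := ler_wpM2r (ltW X0) wA; nra.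
rewrite -mulrA ler_pM2l//; lra.
Qed.

End perpetuity_tail.

(** * The limit for the perpetuity *)

Theorem theorem4 (d : measure_display) (T : measurableType d) (R : realType)
    (P : probability T R) (alpha beta q : R) (M X : {RV P >-> R})
    (alpha_gt0 : 0 < alpha) (beta_gt0 : 0 < beta) (q_gt0 : 0 < q)
    (M01 : forall w : T, 0 <= M w <= 1)
    (M_beta : equivalent_at_1 (distribution P M) (beta_distribution alpha beta))
    (X_perp : is_perpetuity q M X) :
  ln (fine (P [set w | x <= X w])) / (x * ln x) @[x --> +oo] --> - (beta / q).
Proof.
have [eps [D1 [D2 [eps0 D10 D12 Meq]]]] := M_beta.
have [C1 [C2 [C10 C20 beta_tail]]] := beta_distribution_tail alpha_gt0 beta_gt0.
have D20 : 0 < D2 by exact: lt_trans D12.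
pose m delta := fine (distribution P M `]1 - delta, 1]%classic).
have mge0 delta : 0 <= m delta by exact: fine_ge0.
have mle1 delta : m delta <= 1.
  rewrite -[leRHS]/(fine 1%E) fine_le ?fin_num_measure//.
  exact: probability_le1.
(* Equivalence at 1 transfers the order delta^beta from the beta law to [M]; the beta mass is
   positive by [b1], so the quotient can be cleared. *)
have mlo delta : 0 < delta -> delta <= 2^-1 -> delta <= eps ->
    D1 * C1 * delta `^ beta <= m delta.
  move=> d0 d2 de; have /andP[b1 _] := beta_tail delta ltac:(apply/andP; split; lra).
  have /andP[+ _] := Meq delta ltac:(apply/andP; split; lra) de.
  rewrite ler_pdivlMr; last first.
    by apply: lt_le_trans b1; rewrite mulr_gt0 ?powR_gt0.
  by apply: le_trans; rewrite -mulrA ler_pM2l.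
have mup delta : 0 < delta -> delta <= 2^-1 -> delta <= eps ->
    m delta <= D2 * C2 * delta `^ beta.
  move=> d0 d2 de; have /andP[b1 b2] := beta_tail delta ltac:(apply/andP; split; lra).
  have /andP[_ +] := Meq delta ltac:(apply/andP; split; lra) de.
  rewrite ler_pdivrMr; last first.
    by apply: lt_le_trans b1; rewrite mulr_gt0 ?powR_gt0.
  by move/le_trans; apply; rewrite -mulrA ler_pM2l.
pose F u := tail X (u * q).
have -> : (fun x : R => ln (fine (P [set w | x <= X w])) / (x * ln x)) =
    (fun x => ln (F (x / q)) / (x * ln x)).
  by apply/funext => x; rewrite /F divfK ?gt_eqF.
have F1 u : u <= 1 -> F u = 1.
  by move=> u1; apply: (tail_perpetuity1 q_gt0 M01 X_perp); rewrite ler_piMl// ltW.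
(* Beyond this threshold [c / u] lies in the range where both the beta estimate and the equivalence
   hold. *)
have small c u : 0 < c -> Num.max (c / eps) (2 * c) <= u ->
    [/\ 0 < u, c / u <= 2^-1 & c / u <= eps].
  rewrite ge_max => c0 /andP[u1 u2].
  have u0 : 0 < u by lra.
  split=> //; rewrite ler_pdivrMr//; first lra.
  by rewrite mulrC -ler_pdivrMr.
apply: log_tail_limit => //.
(* The constant is the logarithm of D2 C2 2^beta, from D2 C2 (2/(y + 2))^beta after bounding y + 2
   below by y. *)
- apply: (@tail_upper_bound R F (fun y => m (2 / (y + 2))) beta
    (ln (D2 * C2) + beta * ln 2) (Num.max (2 / eps) (2 * 2))) => //.
  + move=> u; rewrite -[leRHS]/(fine 1%E) fine_le ?fin_num_measure//.
      exact: measurable_tail.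
    by apply: probability_le1; exact: measurable_tail.
  + apply: (cvg_comp (fun u => u * q) (tail X) _ (tail_cvg0 X)).
    apply/cvgryPge => A; exists (A / q); split=> [|u Au]; first exact: num_real.
    by rewrite -ler_pdivrMr// ltW.
  + by move=> y y0; exact: (tail_perpetuity_le q_gt0 M01 X_perp).
  + move=> y yl.
    have y0 : 0 < y by have [] := small 2 y ltac:(lra) yl.
    have [y20 s1 s2] := small 2 (y + 2) ltac:(lra) ltac:(lra).
    apply: le_trans (mup _ _ s1 s2) _; first by rewrite divr_gt0.
    rewrite -ler_ln ?posrE ?expR_gt0 ?mulr_gt0 ?powR_gt0 ?divr_gt0// expRK.
    rewrite [ln (_ * _ `^ _)]lnM ?posrE ?mulr_gt0 ?powR_gt0 ?divr_gt0// ln_powR ln_div ?posrE//.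
    have : ln y <= ln (y + 2) by rewrite ler_ln ?posrE//; lra.
    by rewrite -(ler_pM2l beta_gt0); lra.
- move=> theta th01; have /andP[th0 th1] := th01.
  (* Expanding the logarithm of D1 C1 (theta/u)^beta gives this constant minus beta ln u. *)
  exists (ln (D1 * C1) + beta * ln theta), (Num.max 1 (Num.max (theta / eps) (2 * theta))).
  move=> u; rewrite ge_max => /andP[u1 /(small _ _ th0)[u0 s1 s2]].
  have := mlo _ _ s1 s2; rewrite divr_gt0// => /(_ isT) mu.
  have mu0 : 0 < m (theta / u).
    by apply: lt_le_trans mu; rewrite !mulr_gt0// powR_gt0// divr_gt0.
  have [] := @tail_lower_bound R F m F1 _ _ theta u th01 u1.
  + by move=> x y xy; apply: tail_nonincreasing; rewrite ler_pM2r.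
  + by move=> y delta y1 d01; exact: (tail_perpetuity_ge q_gt0 X_perp).
  + by rewrite mu0 mle1.
  move=> F0 Flo; split=> //; apply: le_trans Flo.
  rewrite ler_wpM2l ?divr_ge0 ?(ltW u0)//; first lra.
  apply: (@le_trans _ _ (ln (D1 * C1 * (theta / u) `^ beta))).
    rewrite [ln (_ * _ `^ _)]lnM ?posrE ?mulr_gt0 ?powR_gt0 ?divr_gt0// ln_powR ln_div ?posrE//.
    lra.
  by rewrite ler_ln ?posrE// !mulr_gt0 ?powR_gt0 ?divr_gt0.
Qed.
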